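(* For all integers $\mu,k,t,p,l$ with $k<t$, $t+k\le p$ and $p\le l$, there exists a classical $(p,t,0,0)$ threshold secret sharing scheme for $l$-bit messages with shares of $l+\mu+o(l+\mu)$ bits, which is perfectly correct and perfectly private and is $p\cdot2^{-\tilde\Omega((\frac{l+\mu}{p})^{1/3})}$-leakage-resilient against the quantum $k$-local leakage family $\mathcal F^{p,t}_{k,\mu}$.
   Context: A classical $(p,t,\varepsilon_{priv},\varepsilon_c)$ secret sharing scheme: randomized $\mathrm{Share}:\{0,1\}^l\to(\{0,1\}^{l'})^p$ and reconstruction from any $T$ with $|T|\ge t$ failing with probability $\le\varepsilon_c$, while any $\le t-1$ shares of two messages are within statistical distance $\varepsilon_{priv}$. The family $\mathcal F^{p,t}_{k,\mu}$ consists of triples $(T,K,\Lambda)$ with $T,K\subseteq[p]$, $|T|<t$, $|K|\le k$, and $\Lambda$ a channel mapping $\{0,1\}^{l'|K|}$ to density matrices on $\mu$ qubits; a leakage query on message $m$ returns the state $(\mathrm{id}_T\otimes\Lambda_K)(\mathrm{Share}(m)_{T\cup K})$, i.e. the shares in $T$ together with the $\mu$-qubit state $\Lambda$ applied jointly to the shares in $K$. The scheme is $\varepsilon$-leakage-resilient against the family if for every query and every $m_0,m_1$ the resulting states are within trace distance $\varepsilon$. $\tilde\Omega$ hides polylogarithmic factors. *)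

(* Defs.v *)
(* mathcomp + mathcomp-analysis (realType, sup, powR, ln)
   + mathcomp-real-closed (complex numbers R[i], tensor product of matrices). *)
From HB Require Import structures.
From mathcomp Require Import all_boot all_order all_algebra.
From mathcomp Require Import complex mxtens.
From mathcomp Require Import classical_sets boolp reals exp.

Set Implicit Arguments.
Unset Strict Implicit.
Unset Printing Implicit Defensive.

Import Order.TTheory GRing.Theory Num.Theory.
Local Open Scope classical_set_scope.
Local Open Scope ring_scope.

(* Classical objects                                                   *)

(* bit strings of length n *)
Definition bitstr (n : nat) := n.-tuple bool.

(* a full vector of p shares, each an l'-bit string *)
Definition shares (p l' : nat) := {ffun 'I_p -> bitstr l'}.

Definition zero_bits (n : nat) : bitstr n := nseq_tuple n false.

(* keep the shares with index in T, blank out (fixed all-zero string) the others;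
   [mask T s] is the classical content of Share(m)_T. *)
Definition mask (p l' : nat) (T : {set 'I_p}) (s : shares p l') : shares p l' :=
  [ffun i => if i \in T then s i else zero_bits l'].

(* f is a probability distribution on the finite type A *)
Definition is_distr (R : realType) (A : finType) (f : A -> R) : Prop :=
  (forall a, 0 <= f a) /\ \sum_(a : A) f a = 1.

(* Statistical distance between the distributions of Share(m0)_T and Share(m1)_T *)
Definition marg_sd (R : realType) (p l' l : nat) (Share : bitstr l -> shares p l' -> R)
    (T : {set 'I_p}) (m0 m1 : bitstr l) : R :=
  2^-1 * \sum_(y : shares p l')
     `| \sum_(s : shares p l' | mask T s == y) (Share m0 s - Share m1 s) |.

(* A classical (p, t, eps_priv, eps_c) secret sharing scheme for l-bit messages
   with l'-bit shares.  Share m is the (randomized) share distribution on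
   ({0,1}^l')^p; Rec T reconstructs from the shares in T. *)
Definition secret_sharing (R : realType) (p t l l' : nat) (eps_priv eps_c : R)
    (Share : bitstr l -> shares p l' -> R)
    (Rec : {set 'I_p} -> shares p l' -> bitstr l) : Prop :=
  [/\ forall m, is_distr (Share m),
      (* correctness: reconstruction from any T with |T| >= t fails w.p. <= eps_c *)
      forall m (T : {set 'I_p}), (t <= #|T|)%N ->
        \sum_(s : shares p l' | Rec T (mask T s) != m) Share m s <= eps_c &
      (* privacy: any <= t-1 shares of two messages are eps_priv-close *)
      forall (T : {set 'I_p}) m0 m1, (#|T| < t)%N -> marg_sd Share T m0 m1 <= eps_priv].

(* Quantum objects (finite-dimensional, complex entries in R[i])      *)

Definition adjmx (R : rcfType) (m n : nat) (A : 'M[R[i]]_(m, n)) : 'M[R[i]]_(n, m) :=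
  (map_mx (fun z => z^*) A)^T.

(* density matrix: Hermitian, positive semidefinite, unit trace *)
Definition is_density (R : rcfType) (n : nat) (rho : 'M[R[i]]_n) : Prop :=
  [/\ adjmx rho = rho,
      forall v : 'cV[R[i]]_n, 0 <= (adjmx v *m rho *m v) 0 0 &
      \tr rho = 1].

(* orthogonal projector *)
Definition is_projector (R : rcfType) (n : nat) (P : 'M[R[i]]_n) : Prop :=
  P *m P = P /\ adjmx P = P.

(* trace distance  D(rho, sigma) = max_P Tr(P (rho - sigma)), P ranging over projectors *)
Definition trace_dist (R : realType) (n : nat) (rho sigma : 'M[R[i]]_n) : R :=
  sup [set complex.Re (\tr (P *m (rho - sigma))) | P in [set P : 'M[R[i]]_n | is_projector P]].

Definition toC (R : rcfType) (x : R) : R[i] := Complex x 0.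

(* The state (id_T (x) Lambda_K)(Share(m)_{T u K}) :
     sum_s Pr[Share(m) = s] |s_T><s_T| (x) Lambda(s_K),
   the classical register has the computational basis indexed by the (masked) share vectors. *)
Definition leak_state (R : realType) (p l' l mu : nat) (Share : bitstr l -> shares p l' -> R)
    (T : {set 'I_p}) (Lam : shares p l' -> 'M[R[i]]_(2 ^ mu)) (m : bitstr l)
    : 'M[R[i]]_(#|{: shares p l'}| * 2 ^ mu) :=
  \sum_(s : shares p l')
     toC (Share m s) *: (delta_mx (enum_rank (mask T s)) (enum_rank (mask T s)) *t Lam s).

(* membership in the family F^{p,t}_{k,mu}: |T| < t, |K| <= k, and Lambda is a channel
   from the classical string of shares in K to density matrices on mu qubits
   (Lambda s depends only on the shares of s indexed by K). *)
Definition in_leak_family (R : realType) (p t k mu l' : nat)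
    (T K : {set 'I_p}) (Lam : shares p l' -> 'M[R[i]]_(2 ^ mu)) : Prop :=
  [/\ (#|T| < t)%N, (#|K| <= k)%N,
      forall s, Lam s = Lam (mask K s) &
      forall s, is_density (Lam s)].

Definition leakage_resilient (R : realType) (p t k mu l l' : nat) (eps : R)
    (Share : bitstr l -> shares p l' -> R) : Prop :=
  forall (T K : {set 'I_p}) (Lam : shares p l' -> 'M[R[i]]_(2 ^ mu)),
    in_leak_family t k T K Lam ->
    forall m0 m1 : bitstr l,
      trace_dist (leak_state Share T Lam m0) (leak_state Share T Lam m1) <= eps.

(* Main.v *)
Require Import Defs.
From HB Require Import structures.
From mathcomp Require Import all_boot all_order all_algebra.
From mathcomp Require Import complex mxtens.
From mathcomp Require Import classical_sets boolp reals exp.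
From mathcomp Require Import finfield archimedean zify ring lra.
Set Implicit Arguments.
Unset Strict Implicit.
Unset Printing Implicit Defensive.
Import Order.TTheory GRing.Theory Num.Theory.
Local Open Scope ring_scope.

(* The message m is encoded as W = (m + g(u,v), u, v), where u, v are uniform in GF(2^s)
   and g(u,v)_i = <u^(i+1), v>: this is a translate of the powering small-bias set of Alon,
   Goldreich, Hastad and Peralta, with bias at most l / 2^s.  W is then Shamir-shared over
   GF(2^(l + 2 s)).

   Given shares T and a leak Lam on shares K, the sharing randomness can be resampled so that,
   up to variables independent of W, the register T reveals a uniform a while Lam sees only
   a + W.  So the two leaked states differ, on average over a, by the convolution of a
   matrix-valued function with a difference of two small-bias distributions; by Parseval
   its mean square Frobenius norm is at most (2 l / 2^s)^2, because density matrices have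
   Frobenius norm at most 1.  Passing to the trace norm costs 2^(mu/2), so 2 s = mu + O(sqrt n),
   with n = l + mu, gives an error below 2^(-sqrt n). *)

(** * Shamir sharing over binary fields *)

(** A field with 2^N elements is an N-dimensional vector space over its prime field; coordinates in
    a basis give the additive bijection. *)
Lemma binary_field_exists (N : nat) : (0 < N)%N ->
  exists (F : finFieldType) (phi : 'rV['F_2]_N -> F) (psi : F -> 'rV['F_2]_N),
    [/\ cancel phi psi, cancel psi phi & {morph phi : x y / x + y}].
Proof.
move=> N_gt0; have [F charF cardF] := pPrimePowerField (isT : prime 2) N_gt0.
have [v2r lin_v2r [r2v v2rK r2vK]] := pprimeChar_vectAxiom charF.
have logF : logn 2 #|F| = N by rewrite cardF pfactorK.
pose v2r' (x : F) : 'rV['F_2]_(logn 2 #|F|) := v2r x.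
pose r2v' (x : 'rV['F_2]_(logn 2 #|F|)) : F := r2v x.
have v2rD : {morph v2r' : x y / x + y}.
  move=> x y; have := lin_v2r 1 x y; rewrite !scale1r; exact.
(* The coordinate vectors have length [logn 2 #|F|]; the maps are generalized so that this length
   can be rewritten to [N]. *)
move: @v2r' @r2v' (v2rK : cancel v2r r2v) (r2vK : cancel r2v v2r) v2rD => /=.
move: (v2r : F -> 'rV['F_2]_(logn 2 #|F|)) (r2v : 'rV['F_2]_(logn 2 #|F|) -> F).
rewrite logF => f g fK gK fD; exists F, g, f; split=> // x y.
by rewrite -{1}[x]gK -{1}[y]gK -fD fK.
Qed.

Section Shamir.
Variables (F : finFieldType) (p d : nat) (alpha : 'I_p -> F).
Hypothesis alpha_inj : injective alpha.
Hypothesis alpha_neq0 : forall i, alpha i != 0.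

(* Value at [alpha i] of the polynomial with constant term 0 and higher coefficients [c]. *)
Definition blinding (c : 'rV[F]_d) (i : 'I_p) : F := (rVpoly c).[alpha i] * alpha i.

Lemma blindingD c c' i : blinding (c + c') i = blinding c i + blinding c' i.
Proof. by rewrite /blinding linearD hornerD mulrDl. Qed.

Lemma blindingZ a c i : blinding (a *: c) i = a * blinding c i.
Proof. by rewrite /blinding linearZ hornerZ mulrA. Qed.

(** The product of the factors 1 - X / alpha_i over [T], minus 1, has no constant term, degree at
    most [d] and value -1 on [T]. Adding W times its coefficients to the coins thus cancels a secret
    W on all of [T]. *)
Lemma blinding_cancel (T : {set 'I_p}) : (#|T| <= d)%N ->
  exists c, forall i, i \in T -> blinding c i = -1.
Proof.
move=> Td; pose q := \prod_(i in T) (1 - (alpha i)^-1 *: 'X) : {poly F}.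
have q0 : q.[0] = 1.
  rewrite horner_prod big1 // => i _; by rewrite !hornerE subr0.
have dvdX : 'X %| q - 1 by rewrite -['X]subr0 -polyC0 dvdp_XsubCl /root !hornerE q0 subrr.
have size_fac i : size (1 - (alpha i)^-1 *: 'X : {poly F}) = 2.
  rewrite addrC size_polyDl ?size_polyN ?size_scale ?invr_eq0 ?size_polyX ?size_poly1 //.
have sq : (size q <= #|T|.+1)%N.
  rewrite /q (leq_trans (size_prod_leq _ _)) //.
  rewrite (eq_bigr (fun=> 2)) ?sum_nat_const => [|i _]; last exact: size_fac.
  by rewrite muln2 -addnn -addSn addnK.
have := divpK dvdX; set r := (q - 1) %/ 'X => rE.
have sr : (size r <= d)%N.
  have [->|r0] := eqVneq r 0; first by rewrite size_poly0.
  have: (size (r * 'X)%R <= #|T|.+1)%N.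
    rewrite rE (leq_trans (size_polyD _ _)) // geq_max sq size_polyN size_poly1 //.
  by rewrite (size_mulX r0) ltnS => /leq_trans; apply.
exists (poly_rV r) => i iT; rewrite /blinding poly_rV_K //.
have -> : r.[alpha i] * alpha i = (r * 'X).[alpha i] by rewrite !hornerE.
rewrite rE !hornerE.
have -> : q.[alpha i] = 0.
  apply/eqP; rewrite horner_prod prodf_seq_eq0; apply/hasP.
  exists i; rewrite ?mem_index_enum //= iT /= !hornerE mulVf ?subrr //.
by rewrite sub0r.
Qed.

(** The polynomial W + X c(X) has degree at most [d] but more than [d] distinct roots. *)
Lemma blinding_secret (T : {set 'I_p}) (W : F) (c : 'rV[F]_d) :
  (d < #|T|)%N -> (forall i, i \in T -> W + blinding c i = 0) -> W = 0.
Proof.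
move=> dT H; pose P := W%:P + rVpoly c * 'X.
have sP : (size P <= d.+1)%N.
  rewrite (leq_trans (size_polyD _ _)) // geq_max.
  rewrite (leq_trans (size_polyC_leq1 _)) //= (leq_trans (size_polyMleq _ _)) //.
  rewrite size_polyX addn2 /= ltnS; exact: size_poly.
have P0 : P = 0.
  apply: (@roots_geq_poly_eq0 _ P [seq alpha i | i in T]).
  - apply/allP => x /fintype.imageP [i iT ->].
    by rewrite /root !hornerE H.
  - by rewrite map_inj_uniq ?enum_uniq.
  - by rewrite size_map -cardE (leq_trans sP).
have := congr1 (fun Q : {poly F} => Q.[0]) P0.
by rewrite hornerD hornerC hornerM hornerX mulr0 addr0 horner0.
Qed.
End Shamir.

(** * Fourier analysis on bit vectors *)

Section Characters.
Variable R : realFieldType.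

Definition sign2 (z : 'F_2) : R := (-1) ^+ (z : nat).

Lemma sign2D : {morph sign2 : x y / x + y >-> x * y}.
Proof.
case=> [[|[|//]] ?] [[|[|//]] ?];
  by rewrite /sign2 /= /Zp_add /= ?expr0 ?expr1 ?mulr1 ?mul1r ?mulrNN ?mulr1.
Qed.

Lemma sign2_neq0 (z : 'F_2) : z != 0 -> sign2 z = -1.
Proof. by case: z => [[|[|//]] ?]. Qed.

Definition dot n (b x : 'rV['F_2]_n) : 'F_2 := \sum_i b 0 i * x 0 i.

Lemma dotDr n (b : 'rV_n) : {morph dot b : x y / x + y}.
Proof. by move=> x y; rewrite -big_split; apply: eq_bigr => i _; rewrite mxE mulrDr. Qed.

Lemma dotDl n (x : 'rV_n) : {morph (dot (n := n))^~ x : b c / b + c}.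
Proof. by move=> b c; rewrite -big_split; apply: eq_bigr => i _; rewrite mxE mulrDl. Qed.

Lemma dotC n (b x : 'rV_n) : dot b x = dot x b.
Proof. by apply: eq_bigr => i _; rewrite mulrC. Qed.

Lemma dot0 n (x : 'rV_n) : dot 0 x = 0.
Proof. by apply: big1 => i _; rewrite mxE mul0r. Qed.

Lemma dotZl n a (b x : 'rV_n) : dot (a *: b) x = a * dot b x.
Proof. by rewrite mulr_sumr; apply: eq_bigr => i _; rewrite mxE mulrA. Qed.

Lemma dot_row_mx n1 n2 (b1 x1 : 'rV_n1) (b2 x2 : 'rV_n2) :
  dot (row_mx b1 b2) (row_mx x1 x2) = dot b1 x1 + dot b2 x2.
Proof.
rewrite /dot big_split_ord /=.
by congr (_ + _); apply: eq_bigr => i _; rewrite ?row_mxEl ?row_mxEr.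
Qed.

Definition chi n (b x : 'rV['F_2]_n) : R := sign2 (dot b x).

Lemma chiDr n (b : 'rV_n) : {morph chi b : x y / x + y >-> x * y}.
Proof. by move=> x y; rewrite /chi dotDr sign2D. Qed.

Lemma chiDl n (x : 'rV_n) : {morph (chi (n := n))^~ x : b c / b + c >-> b * c}.
Proof. by move=> b c; rewrite /chi dotDl sign2D. Qed.

Lemma chiC n (b x : 'rV_n) : chi b x = chi x b.
Proof. by rewrite /chi dotC. Qed.

Lemma chi0 n (x : 'rV_n) : chi 0 x = 1.
Proof. by rewrite /chi dot0. Qed.

Lemma normr_chi n (b x : 'rV_n) : `|chi b x| = 1.
Proof. by rewrite /chi /sign2 normr_sign. Qed.

(** For nonzero [b], translating by a basis vector at which [b] does not vanish negates the sum. *)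
Lemma sum_chi n (b : 'rV['F_2]_n) :
  \sum_x chi b x = if b == 0 then #|{: 'rV['F_2]_n}|%:R else 0.
Proof.
case: eqVneq => [->|b0].
  by rewrite (eq_bigr (fun=> 1)) ?sumr_const // => x _; rewrite chi0.
have /rV0Pn [i bi] := b0.
have chi_i : chi b (delta_mx 0 i) = -1.
  rewrite /chi sign2_neq0 // /dot (bigD1 i) //= big1 ?addr0 => [|j ji].
    by rewrite mxE !eqxx mulr1.
  by rewrite mxE (negbTE ji) andbF mulr0.
set S := \sum_x _; suff : S = - S by move=> ?; lra.
rewrite {1}/S (reindex_inj (addrI (delta_mx 0 i))) /= /S -sumrN.
by apply: eq_bigr => x _; rewrite chiDr chi_i mulN1r.
Qed.

Lemma F2_addr_eq0 n (b c : 'rV['F_2]_n) : (b + c == 0) = (b == c).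
Proof.
have cN : - c = c.
  by apply/rowP => i; rewrite mxE; case: (c 0 i) => [[|[|//]] ?]; apply: val_inj.
by rewrite -{1}cN subr_eq0.
Qed.

Lemma convolution_l2_le (W : finType) n (e0 e1 : W -> 'rV['F_2]_n) (eta : R)
    (f : 'rV['F_2]_n -> R) :
  (forall b, `|\sum_w chi b (e0 w) - \sum_w chi b (e1 w)| <= eta) ->
  \sum_a (\sum_w f (a + e0 w) - \sum_w f (a + e1 w)) ^+ 2
    <= eta ^+ 2 * \sum_x f x ^+ 2.
Proof.
(* By Parseval, the convolution acts as the multiplier [D] below. *)
move=> le_eta; set M := #|{: 'rV['F_2]_n}|%:R : R.
have M_gt0 : 0 < M.
  by rewrite ltr0n; apply/card_gt0P; exists 0.
(* Fourier coefficients, normalized so that inversion carries no constant; the factor [M] then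
   appears in [parseval]. *)
pose fh b := M^-1 * \sum_x f x * chi b x.
have inv x : f x = \sum_b fh b * chi b x.
  rewrite /fh; under eq_bigr do rewrite -mulrA mulr_suml.
  rewrite -mulr_sumr exchange_big /=.
  under eq_bigr => y _.
    under eq_bigr => b _ do rewrite -mulrA -(chiDr b) chiC.
    rewrite -mulr_sumr sum_chi F2_addr_eq0.
    over.
  rewrite (bigD1 x) //= eqxx big1 ?addr0 => [|y /negbTE ->]; last by rewrite mulr0.
  by rewrite mulrCA mulVf ?mulr1 // gt_eqF.
have parseval (g : 'rV_n -> R) : \sum_a (\sum_b g b * chi b a) ^+ 2 = M * \sum_b g b ^+ 2.
  under eq_bigr => a _.
    rewrite expr2 mulr_suml.
    under eq_bigr => b _ do rewrite mulr_sumr.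
    over.
  rewrite exchange_big mulr_sumr /=; apply: eq_bigr => b _.
  rewrite exchange_big /=.
  under eq_bigr => c _.
    under eq_bigr => a _ do rewrite mulrACA -(chiDl a).
    rewrite -mulr_sumr sum_chi F2_addr_eq0.
    over.
  rewrite (bigD1 b) //= eqxx big1 ?addr0 => [|c]; last first.
    by rewrite eq_sym => /negbTE ->; rewrite mulr0.
  by rewrite -/M mulrC expr2.
pose D b := \sum_w chi b (e0 w) - \sum_w chi b (e1 w).
have shift (e : W -> 'rV_n) a : \sum_w f (a + e w) = \sum_b fh b * chi b a * \sum_w chi b (e w).
  under eq_bigr do rewrite inv.
  rewrite exchange_big /=; apply: eq_bigr => b _; rewrite mulr_sumr.
  by apply: eq_bigr => w _; rewrite chiDr mulrA.
have -> : \sum_a (\sum_w f (a + e0 w) - \sum_w f (a + e1 w)) ^+ 2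
        = \sum_a (\sum_b (fh b * D b) * chi b a) ^+ 2.
  apply: eq_bigr => a _; rewrite !shift -sumrB; congr (_ ^+ 2).
  by apply: eq_bigr => b _; rewrite -mulrBr mulrAC.
under [X in _ <= _ * X]eq_bigr do rewrite inv.
rewrite !parseval mulrCA; apply: ler_wpM2l; first exact: ltW.
rewrite mulr_sumr; apply: ler_sum => b _; rewrite exprMn mulrC.
apply: ler_wpM2r; first exact: sqr_ge0.
by rewrite -[D b ^+ 2]real_normK ?num_real // lerXn2r ?nnegrE ?normr_ge0 // (le_trans _ (le_eta b)).
Qed.
End Characters.

(** * Density matrices and projectors in the Frobenius norm *)

Lemma mulmx_bilinear2 (V : comNzRingType) n (M : 'M[V]_n) (a b c d : V)
    (u v : 'rV_n) (x y : 'cV_n) :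
  ((a *: u + b *: v) *m M *m (c *: x + d *: y)) 0 0
    = a * c * (u *m M *m x) 0 0 + a * d * (u *m M *m y) 0 0
      + (b * c * (v *m M *m x) 0 0 + b * d * (v *m M *m y) 0 0).
Proof.
rewrite mulmxDl mulmxDl !mulmxDr -!scalemxAl -!scalemxAr.
move: (u *m M *m x) (u *m M *m y) (v *m M *m x) (v *m M *m y) => A B C D.
by rewrite !mxE !mulrA.
Qed.

Local Notation Re := complex.Re.
Local Notation Im := complex.Im.

Section FrobeniusNorm.
Variable R : rcfType.
Implicit Types (z : R[i]).

Lemma Re_add z1 z2 : Re (z1 + z2) = Re z1 + Re z2.
Proof. by case: z1 z2 => [? ?] []. Qed.

Lemma Im_add z1 z2 : Im (z1 + z2) = Im z1 + Im z2.
Proof. by case: z1 z2 => [? ?] []. Qed.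

Lemma Re_mul z1 z2 : Re (z1 * z2) = Re z1 * Re z2 - Im z1 * Im z2.
Proof. by case: z1 z2 => [? ?] []. Qed.

Lemma Im_mul z1 z2 : Im (z1 * z2) = Re z1 * Im z2 + Im z1 * Re z2.
Proof. by case: z1 z2 => [? ?] []. Qed.

Lemma Re_sum (I : Type) (r : seq I) (P : pred I) (F : I -> R[i]) :
  Re (\sum_(i <- r | P i) F i) = \sum_(i <- r | P i) Re (F i).
Proof. by elim/big_rec2: _ => // i x y _ <-; rewrite Re_add. Qed.

Lemma Im_sum (I : Type) (r : seq I) (P : pred I) (F : I -> R[i]) :
  Im (\sum_(i <- r | P i) F i) = \sum_(i <- r | P i) Im (F i).
Proof. by elim/big_rec2: _ => // i x y _ <-; rewrite Im_add. Qed.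

Lemma Re_conj z : Re z^* = Re z. Proof. by case: z. Qed.
Lemma Im_conj z : Im z^* = - Im z. Proof. by case: z. Qed.
Lemma Re_opp z : Re (- z) = - Re z. Proof. by case: z. Qed.
Lemma Im_opp z : Im (- z) = - Im z. Proof. by case: z. Qed.

Definition normsq z : R := Re z ^+ 2 + Im z ^+ 2.

Lemma normsq_ge0 z : 0 <= normsq z.
Proof. by rewrite addr_ge0 ?sqr_ge0. Qed.

Definition frobenius_sq m n (A : 'M[R[i]]_(m, n)) : R := \sum_i \sum_j normsq (A i j).

Lemma adjmx_entry n (A : 'M[R[i]]_n) i j : adjmx A = A -> (A i j)^* = A j i.
Proof. by move=> hA; rewrite -{2}hA /adjmx !mxE. Qed.

(** Positivity on the vector a e_i - conj(rho_ij) e_j gives a quadratic in the real number a; a good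
    choice of a yields the 2 x 2 principal minor. *)
Lemma density_minor n (rho : 'M[R[i]]_n) i j : is_density rho ->
  normsq (rho i j) <= Re (rho i i) * Re (rho j j).
Proof.
case=> herm psd _.
have diag k : 0 <= Re (rho k k).
  have := psd (delta_mx k 0); rewrite lecE => /andP [_] /=.
  rewrite /adjmx map_delta_mx trmx_delta -rowE !mxE (bigD1 k) //= big1 => [|l lk].
    by rewrite !mxE !eqxx mulr1 addr0.
  by rewrite !mxE (negbTE lk) mulr0.
have quad (a : R) : 0 <= a ^+ 2 * Re (rho i i) - 2 * a * normsq (rho i j)
                         + normsq (rho i j) * Re (rho j j).
  pose b := - (rho i j)^*; pose x : 'cV[R[i]]_n := toC a *: delta_mx i 0 + b *: delta_mx j 0.
  have := psd x; rewrite lecE => /andP [_]; congr (_ <= _).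
  have entry k l : (delta_mx 0 k *m rho *m delta_mx l 0 : 'M_1) 0 0 = rho k l.
    by rewrite -rowE -colE !mxE.
  have adjx : adjmx x = (toC a)^* *: delta_mx 0 i + b^* *: delta_mx 0 j.
    by rewrite /adjmx /x map_mxD !map_mxZ !map_delta_mx linearD !linearZ /= !trmx_delta.
  rewrite adjx /x mulmx_bilinear2 !entry -(adjmx_entry i j herm).
  rewrite !(Re_add, Re_mul, Im_mul, Re_conj, Im_conj, Re_opp, Im_opp) /b /toC /normsq /=.
  by ring.
(* If rho_jj > 0, the choice a = rho_jj leaves rho_jj times the minor. *)
have [D0|D_neq0] := eqVneq (Re (rho j j)) 0; last first.
  have D_gt0 : 0 < Re (rho j j) by rewrite lt_neqAle eq_sym D_neq0 diag.
  have := quad (Re (rho j j)).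
  rewrite (_ : _ + _ = Re (rho j j) * (Re (rho i i) * Re (rho j j) - normsq (rho i j))).
    by rewrite pmulr_rge0 // subr_ge0.
  by ring.
rewrite D0 mulr0; set A := Re (rho i i) in quad *; set r := normsq _ in quad *.
have A_ge0 : 0 <= A by exact: diag.
have r_ge0 : 0 <= r by exact: normsq_ge0.
(* When rho_jj = 0, this a makes the quadratic negative unless r = 0; the 1 keeps the denominator
   positive. *)
have := quad (r / (A + 1)); rewrite D0 mulr0 addr0.
have A1 : A + 1 != 0 by rewrite gt_eqF // ltr_wpDl.
have -> : (r / (A + 1)) ^+ 2 * A - 2 * (r / (A + 1)) * r
        = - ((r / (A + 1)) ^+ 2 * (A + 2)) by field.
rewrite oppr_ge0 pmulr_lle0; last by lra.
move=> sq_le0; have : (r / (A + 1)) ^+ 2 = 0 by apply/eqP; rewrite eq_le sq_le0 sqr_ge0.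
by move/eqP; rewrite sqrf_eq0 mulf_eq0 invr_eq0 (negbTE A1) orbF => /eqP ->.
Qed.

(** Summing the minor inequality over all i and j gives the squared trace on the right. *)
Lemma density_frobenius_le1 n (rho : 'M[R[i]]_n) : is_density rho -> frobenius_sq rho <= 1.
Proof.
move=> dens; have [_ _ tr1] := dens.
have tr1R : \sum_i Re (rho i i) = 1 by rewrite -Re_sum -[LHS]/(Re (\tr rho)) tr1.
rewrite -[1]mulr1 -{1}tr1R -tr1R mulr_suml; apply: ler_sum => i _.
by rewrite mulr_sumr; apply: ler_sum => j _; exact: density_minor.
Qed.

(** The squared norm of row k equals [P k k] and contains the square of [P k k] as a term, so
    [P k k] is at most 1. *)
Lemma projector_row_le1 n (P : 'M[R[i]]_n) k : is_projector P ->
  \sum_l normsq (P k l) <= 1.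
Proof.
case=> idem herm; have rowE : Re (P k k) = \sum_l normsq (P k l).
  rewrite -{1}idem mxE Re_sum; apply: eq_bigr => l _.
  by rewrite -(adjmx_entry k l herm) Re_mul Re_conj Im_conj mulrN opprK.
have: Re (P k k) ^+ 2 <= Re (P k k).
  rewrite {2}rowE (bigD1 k) //= /normsq -addrA lerDl addr_ge0 ?sqr_ge0 //.
  by apply: sumr_ge0 => l _; exact: normsq_ge0.
by rewrite -rowE; nra.
Qed.

Lemma sum_mxtens_index (V : nmodType) m n (F : 'I_(m * n) -> V) :
  \sum_k F k = \sum_i \sum_j F (mxtens_index (i, j)).
Proof.
rewrite (reindex (@mxtens_index m n)) /=; last first.
  by exists (@mxtens_unindex m n) => k _; rewrite (mxtens_indexK, mxtens_unindexK).
by rewrite pair_big; apply: eq_bigr => -[].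
Qed.

Lemma trace_block m n (P : 'M[R[i]]_(m * n)) y (X : 'M[R[i]]_n) :
  \tr (P *m (delta_mx y y *t X))
    = \sum_i \sum_j P (mxtens_index (y, i)) (mxtens_index (y, j)) * X j i.
Proof.
rewrite /mxtrace sum_mxtens_index (bigD1 y) //= [X in _ + X]big1 ?addr0 => [|k ky].
  apply: eq_bigr => i _; rewrite mxE sum_mxtens_index (bigD1 y) //= [X in _ + X]big1 ?addr0.
    by apply: eq_bigr => j _; rewrite tensmxE mxE !eqxx mul1r.
  by move=> l ly; apply: big1 => j _; rewrite tensmxE mxE (negbTE ly) mul0r mulr0.
apply: big1 => i _; rewrite mxE sum_mxtens_index big1 // => l _.
by apply: big1 => j _; rewrite tensmxE mxE (negbTE ky) andbF mul0r mulr0.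
Qed.

(** Weighted AM-GM on each entry; the [n] rows of the diagonal block of [P] at [y] have norm at most
    1. The bound is linear in the squared norm of [X], hence can be summed over the pads before
    [lam] is fixed. *)
Lemma Re_trace_block_le m n (P : 'M[R[i]]_(m * n)) y (X : 'M[R[i]]_n) (lam : R) :
  is_projector P -> 0 < lam ->
  Re (\tr (P *m (delta_mx y y *t X))) <= lam / 2 * n%:R + (2 * lam)^-1 * frobenius_sq X.
Proof.
move=> projP lam_gt0; rewrite trace_block Re_sum.
have amgm z1 z2 : Re (z1 * z2) <= lam / 2 * normsq z1 + (2 * lam)^-1 * normsq z2.
  rewrite Re_mul /normsq; move: (Re z1) (Im z1) (Re z2) (Im z2) => a b c d.
  rewrite -subr_ge0.
  have -> : lam / 2 * (a ^+ 2 + b ^+ 2) + (2 * lam)^-1 * (c ^+ 2 + d ^+ 2) - (a * c - b * d)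
          = (2 * lam)^-1 * ((lam * a - c) ^+ 2 + (lam * b + d) ^+ 2).
    by field; rewrite gt_eqF.
  by rewrite mulr_ge0 ?addr_ge0 ?sqr_ge0 // invr_ge0 mulr_ge0 // ltW.
apply: le_trans (_ : \sum_i \sum_j (lam / 2 * normsq (P (mxtens_index (y, i)) (mxtens_index (y, j)))
                                    + (2 * lam)^-1 * normsq (X j i)) <= _).
  by apply: ler_sum => i _; rewrite Re_sum; apply: ler_sum => j _; exact: amgm.
under eq_bigr do rewrite big_split /= -!mulr_sumr.
rewrite big_split /= -!mulr_sumr [X in _ + _ * X]exchange_big; apply: lerD => //.
apply: ler_wpM2l; first by rewrite divr_ge0 // ltW.
have <- : \sum_(j < n) (1 : R) = n%:R by rewrite sumr_const card_ord.
apply: ler_sum => i _.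
apply: le_trans (projector_row_le1 (mxtens_index (y, i)) projP).
rewrite sum_mxtens_index (bigD1 y) //= lerDl.
by apply: sumr_ge0 => l _; apply: sumr_ge0 => j _; exact: normsq_ge0.
Qed.
End FrobeniusNorm.

(** * The small-bias encoding *)

Section SmallBiasEncoding.
Variables (R : realFieldType) (l s : nat) (L : finFieldType).
Variables (phi : 'rV['F_2]_s -> L) (psi : L -> 'rV['F_2]_s).
Hypotheses (phiK : cancel phi psi) (psiK : cancel psi phi).
Hypothesis phiD : {morph phi : x y / x + y}.

(** Exponents start at 1, so that subtracting a constant from a nontrivial combination of these
    powers cannot give the zero polynomial. *)
Definition power_hash (u v : 'rV['F_2]_s) : 'rV['F_2]_l :=
  \row_i dot (psi (phi u ^+ i.+1)) v.

Definition encode (m : 'rV['F_2]_l) (w : 'rV['F_2]_s * 'rV['F_2]_s) :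
    'rV['F_2]_(l + (s + s)) :=
  row_mx (m + power_hash w.1 w.2) (row_mx w.1 w.2).

Lemma encode_inj m m' w w' : encode m w = encode m' w' -> m = m'.
Proof.
case: w w' => [u v] [u' v'] /eq_row_mx [/= mE /eq_row_mx [uE vE]].
by move: mE; rewrite uE vE => /addIr.
Qed.

(** For fixed [u], the transpose of the linear map [power_hash u]. *)
Definition hash_dual (b : 'rV['F_2]_l) (u : 'rV['F_2]_s) : 'rV['F_2]_s :=
  \sum_i b 0 i *: psi (phi u ^+ i.+1).

Lemma dot_power_hash b u v : dot b (power_hash u v) = dot (hash_dual b u) v.
Proof.
rewrite {1}/dot; under eq_bigr do rewrite mxE -dotZl.
rewrite /hash_dual; elim/big_rec2: _ => [|i x y _ ->]; first by rewrite dot0.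
by rewrite dotDl.
Qed.

(** Each such [phi u] is a root of one nonzero polynomial of degree at most [l]. *)
Lemma card_hash_dual_fiber (b : 'rV['F_2]_l) c : b != 0 ->
  (#|[set u | hash_dual b u == c]| <= l)%N.
Proof.
(* The default 0 is never reached: [insub] succeeds for every index below [l]. *)
move=> b0; pose q : {poly L} := \poly_(i < l) (if insub i is Some j then (b 0 j != 0)%:R else 0).
pose Q := q * 'X - (phi c)%:P.
have phi0 : phi 0 = 0 by apply: (addIr (phi 0)); rewrite -phiD !add0r.
have phiZ (a : 'F_2) x : phi (a *: x) = (a != 0)%:R * phi x.
  case: a => [[|[|//]] lt_a2].
    by rewrite (_ : Ordinal _ = 0) ?scale0r ?eqxx ?mul0r //; apply: val_inj.
  by rewrite (_ : Ordinal _ = 1) ?scale1r ?oner_eq0 ?mul1r //; apply: val_inj.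
have qE j : q`_(val j) = (b 0 j != 0)%:R by rewrite coef_poly ltn_ord valK.
have Q_root u : root Q (phi u) = (hash_dual b u == c).
  rewrite /root /Q hornerD hornerN hornerC subr_eq0 -(inj_eq (can_inj phiK)).
  congr (_ == _); rewrite hornerM hornerX (horner_coef_wide _ (size_poly _ _)) mulr_suml.
  rewrite /hash_dual (big_morph phi phiD phi0); apply: eq_bigr => j _.
  by rewrite qE phiZ psiK exprSr mulrA.
have /rV0Pn [j bj] := b0.
have Q_neq0 : Q != 0.
  apply/eqP => /(congr1 (fun r : {poly L} => r`_j.+1)).
  by rewrite coef0 coefB coefMX coefC /= subr0 qE bj => /eqP; rewrite oner_eq0.
have sizeQ : (size Q <= l.+1)%N.
  rewrite (leq_trans (size_polyD _ _)) // geq_max size_polyN.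
  rewrite (leq_trans (size_polyC_leq1 _)) // andbT (leq_trans (size_polyMleq _ _)) //.
  by rewrite size_polyX addn2 /= ltnS size_poly.
rewrite -ltnS (leq_trans _ sizeQ) // cardE -(size_map phi).
apply: max_poly_roots Q_neq0 _ _.
  by apply/allP => x /seq.mapP [u]; rewrite mem_enum inE => uE ->; rewrite Q_root.
by rewrite map_inj_uniq ?enum_uniq //; exact: can_inj phiK.
Qed.

Lemma sum_chi_encode (b0 : 'rV_l) (b1 b2 : 'rV_s) m :
  \sum_w chi R (row_mx b0 (row_mx b1 b2)) (encode m w)
    = chi R b0 m * \sum_u chi R b1 u * \sum_v chi R (hash_dual b0 u + b2) v.
Proof.
rewrite -(pair_big xpredT xpredT (fun u v => chi R (row_mx b0 (row_mx b1 b2)) (encode m (u, v)))) /=.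
rewrite mulr_sumr; apply: eq_bigr => u _; rewrite !mulr_sumr; apply: eq_bigr => v _.
rewrite /chi /encode !dot_row_mx dotDr dot_power_hash dotDl !sign2D /=; ring.
Qed.

(** If [b0] is nonzero, the sum over v vanishes except for the at most [l] values of u with
    [hash_dual b0 u = b2], each contributing at most 2^s. If [b0 = 0], what remains is a nontrivial
    character of the uniform seed. *)
Lemma encode_bias (b : 'rV_(l + (s + s))) m : b != 0 ->
  `|\sum_w chi R b (encode m w)| <= l%:R * 2 ^+ s.
Proof.
rewrite -[b]hsubmxK -[rsubmx b]hsubmxK; move: (lsubmx b) (lsubmx (rsubmx b)) (rsubmx (rsubmx b)).
move=> {b} b0 b1 b2 b_neq0; rewrite sum_chi_encode normrM normr_chi mul1r.
have cardE n : #|{: 'rV['F_2]_n}|%:R = 2 ^+ n :> R by rewrite card_mx card_ord mul1n natrX.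
have [b0E|b0_neq0] := eqVneq b0 0.
  have hd0 u : hash_dual b0 u = 0.
    by rewrite /hash_dual b0E big1 // => i _; rewrite mxE scale0r.
  under eq_bigr do rewrite hd0 add0r.
  rewrite -mulr_suml !sum_chi.
  have [b1E|] := eqVneq b1 0; last by rewrite mul0r normr0 mulr_ge0 ?exprn_ge0.
  have [b2E|] := eqVneq b2 0; last by rewrite mulr0 normr0 mulr_ge0 ?exprn_ge0.
  by move: b_neq0; rewrite b0E b1E b2E !row_mx0 eqxx.
apply: le_trans (ler_norm_sum _ _ _) _.
apply: le_trans (_ : \sum_(u in [set u | hash_dual b0 u == b2]) 2 ^+ s <= _); last first.
  by rewrite sumr_const -[leLHS]mulr_natl ler_wpM2r ?exprn_ge0 // ler_nat card_hash_dual_fiber.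
rewrite [leRHS]big_mkcond /=; apply: ler_sum => u _.
rewrite normrM normr_chi mul1r sum_chi inE F2_addr_eq0.
by case: ifP => _; rewrite ?normr0 // cardE ger0_norm ?exprn_ge0.
Qed.

(** Taking a difference removes the exception [b = 0], where both sums count the seeds. *)
Lemma encode_bias_diff (b : 'rV_(l + (s + s))) m0 m1 :
  `|\sum_w chi R b (encode m0 w) - \sum_w chi R b (encode m1 w)| <= 2 * (l%:R * 2 ^+ s).
Proof.
have [->|b_neq0] := eqVneq b 0.
  rewrite (eq_bigr (fun=> 1)) => [|w _]; last exact: chi0.
  rewrite [X in _ - X](eq_bigr (fun=> 1)) => [|w _]; last exact: chi0.
  by rewrite subrr normr0 mulr_ge0 // mulr_ge0 ?exprn_ge0.
by rewrite (le_trans (ler_normB _ _)) // mulr2n mulrDl mul1r lerD ?encode_bias.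
Qed.
End SmallBiasEncoding.

(** * The scheme and its leakage resilience *)

Section UniformLaw.
Variables (R : realFieldType) (Omega A : finType) (X : Omega -> A).

Definition law (a : A) : R := (\sum_w (X w == a)%:R) / #|Omega|%:R.

Lemma sum_law (h : A -> R) : \sum_a law a * h a = (\sum_w h (X w)) / #|Omega|%:R.
Proof.
under eq_bigr do rewrite mulrAC mulr_suml.
rewrite -mulr_suml exchange_big /=; congr (_ / _); apply: eq_bigr => w _.
rewrite (bigD1 (X w)) //= eqxx mul1r big1 ?addr0 // => a.
by rewrite eq_sym => /negbTE ->; rewrite mul0r.
Qed.

Lemma sum_law_if (P : pred A) : \sum_(a | P a) law a = (\sum_w (P (X w))%:R) / #|Omega|%:R.
Proof.
rewrite -(sum_law (fun a => (P a)%:R)) big_mkcond.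
by apply: eq_bigr => a _; case: ifP; rewrite ?mulr1 ?mulr0.
Qed.

Lemma law_distr : (0 < #|Omega|)%N ->
  (forall a, 0 <= law a) /\ \sum_a law a = 1.
Proof.
move=> Omega_gt0; split=> [a|]; first by rewrite divr_ge0 // sumr_ge0.
rewrite (sum_law_if xpredT) /= sumr_const divff // pnatr_eq0 -lt0n //.
Qed.
End UniformLaw.

Definition bits_of_row n (x : 'rV['F_2]_n) : bitstr n := [tuple x 0 i != 0 | i < n].
Definition row_of_bits n (m : bitstr n) : 'rV['F_2]_n := \row_i (tnth m i)%:R.

Lemma row_of_bitsK n : cancel (@row_of_bits n) (@bits_of_row n).
Proof. by move=> m; apply/eq_from_tnth => i; rewrite tnth_mktuple mxE; case: (tnth m i). Qed.

Lemma bits_of_rowK n : cancel (@bits_of_row n) (@row_of_bits n).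
Proof.
move=> x; apply/rowP => i; rewrite mxE tnth_mktuple.
by case: (x 0 i) => [[|[|//]] lt2]; apply: val_inj.
Qed.

(** The scalar bound is applied to the real and imaginary parts of each matrix entry. *)
Lemma frobenius_convolution_le (R : rcfType) (W : finType) n q (e0 e1 : W -> 'rV['F_2]_n)
    (eta : R) (f : 'rV['F_2]_n -> 'M[R[i]]_q) :
  (forall b, `|\sum_w chi R b (e0 w) - \sum_w chi R b (e1 w)| <= eta) ->
  \sum_a frobenius_sq (\sum_w f (a + e0 w) - \sum_w f (a + e1 w))
    <= eta ^+ 2 * \sum_x frobenius_sq (f x).
Proof.
move=> le_eta; rewrite /frobenius_sq exchange_big [X in _ * X]exchange_big /= mulr_sumr.
apply: ler_sum => i _; rewrite exchange_big [X in _ * X]exchange_big /= mulr_sumr.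
apply: ler_sum => j _; rewrite /normsq !big_split /= mulrDr.
have entry a : (\sum_w f (a + e0 w) - \sum_w f (a + e1 w)) i j
             = \sum_w f (a + e0 w) i j - \sum_w f (a + e1 w) i j.
  by rewrite mxE [X in _ + X]mxE !summxE.
apply: lerD.
  under eq_bigr do rewrite entry Re_add Re_opp !Re_sum.
  exact: (convolution_l2_le (fun x => Re (f x i j)) le_eta).
under eq_bigr do rewrite entry Im_add Im_opp !Im_sum.
exact: (convolution_l2_le (fun x => Im (f x i j)) le_eta).
Qed.

Section Scheme.
Variables (R : realType) (p d l s : nat) (L F : finFieldType).
Local Notation N := (l + (s + s))%N.
Variables (phi : 'rV['F_2]_s -> L) (psi : L -> 'rV['F_2]_s).
Variables (Phi : 'rV['F_2]_N -> F) (Psi : F -> 'rV['F_2]_N).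
Variable alpha : 'I_p -> F.
Hypotheses (phiK : cancel phi psi) (psiK : cancel psi phi).
Hypotheses (PhiK : cancel Phi Psi) (PsiK : cancel Psi Phi).
Hypotheses (phiD : {morph phi : x y / x + y}) (PhiD : {morph Phi : x y / x + y}).
Hypotheses (alpha_inj : injective alpha) (alpha_neq0 : forall i, alpha i != 0).

Local Notation blind := (blinding (d := d) alpha).
Local Notation coins := (('rV['F_2]_s * 'rV['F_2]_s) * 'rV[F]_d)%type.

Definition to_shares (y : 'I_p -> F) : shares p N := [ffun i => bits_of_row (Psi (y i))].

Definition secret (m : bitstr l) w : F := Phi (encode phi psi (row_of_bits m) w).

Definition deal (m : bitstr l) (r : coins) : shares p N :=
  to_shares (fun i => secret m r.1 + blind r.2 i).

Definition share (m : bitstr l) : shares p N -> R := law R (deal m).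

(** Exhaustive search for a message consistent with the shares; [zero_bits] is returned only when
    there is none. *)
Definition reconstruct (T : {set 'I_p}) (y : shares p N) : bitstr l :=
  odflt (zero_bits l) [pick m | [exists r, Defs.mask T (deal m r) == y]].

Lemma card_coins_gt0 : (0 < #|{: coins}|)%N.
Proof. by apply/card_gt0P; exists ((0, 0), 0). Qed.

Lemma mask_to_shares (T : {set 'I_p}) y y' : {in T, y =1 y'} ->
  Defs.mask T (to_shares y) = Defs.mask T (to_shares y').
Proof. by move=> eqT; apply/ffunP => i; rewrite !ffunE; case: ifP => // /eqT ->. Qed.

Lemma mask_to_shares_inj (T : {set 'I_p}) y y' :
  Defs.mask T (to_shares y) = Defs.mask T (to_shares y') -> {in T, y =1 y'}.
Proof.
move=> /ffunP eqT i iT; have := eqT i; rewrite !ffunE iT.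
by move=> /(can_inj (@bits_of_rowK _)) /(can_inj PsiK).
Qed.

(** Two dealings that agree on [T] differ by a polynomial of degree at most [d] with more than [d]
    roots, so their secrets coincide, and the encoding determines the message. *)
Lemma reconstruct_deal (T : {set 'I_p}) m r : (d < #|T|)%N ->
  reconstruct T (Defs.mask T (deal m r)) = m.
Proof.
move=> dT; rewrite /reconstruct; case: pickP => [m' /existsP [r' /eqP]|/(_ m)]; last first.
  by move/existsP; case; exists r.
move=> /mask_to_shares_inj eqT /=.
have: secret m' r'.1 - secret m r.1 = 0.
  apply: (blinding_secret alpha_inj dT (c := r'.2 - r.2)) => i iT.
  have := eqT i iT; rewrite -scaleN1r blindingD blindingZ mulN1r => E.
  by rewrite addrACA -opprD E subrr.
move/eqP; rewrite subr_eq0 => /eqP /(can_inj PhiK) /encode_inj.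
exact: (can_inj (@row_of_bitsK _)).
Qed.

(** Resampling: for each seed w, translation by [e w] permutes the Shamir coins. Both the privacy
    and the leakage argument rest on a choice of [e]. *)
Lemma sum_coins (m : bitstr l) (e : 'rV['F_2]_s * 'rV['F_2]_s -> 'rV[F]_d) (V : nmodType)
    (h : shares p N -> V) :
  \sum_r h (deal m r) = \sum_w \sum_c h (deal m (w, c + e w)).
Proof.
rewrite -(pair_big xpredT xpredT (fun w c => h (deal m (w, c)))) /=.
by apply: eq_bigr => w _; rewrite (reindex_inj (addIr (e w))).
Qed.

(** Shifting the coins by the secret times [kT] turns the shares in [T] into pure blinding, whose
    law does not mention the message. *)
Lemma share_private (T : {set 'I_p}) m0 m1 : (#|T| <= d)%N -> marg_sd share T m0 m1 = 0.
Proof.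
move=> Td; rewrite /marg_sd big1 ?mulr0 // => y _.
have [kT kTE] := blinding_cancel alpha_neq0 Td.
have common m : \sum_(x | Defs.mask T x == y) share m x
    = (\sum_(w : 'rV['F_2]_s * 'rV['F_2]_s) \sum_(c : 'rV[F]_d)
        (Defs.mask T (to_shares (blind c)) == y)%:R) / #|{: coins}|%:R.
  rewrite sum_law_if (sum_coins m (fun w => secret m w *: kT) (fun x => (Defs.mask T x == y)%:R)).
  congr (_ / _); apply: eq_bigr => w _; apply: eq_bigr => c _.
  rewrite (@mask_to_shares T _ (blind c)) // => i iT /=.
  by rewrite blindingD blindingZ kTE // mulrN1 addrCA subrr addr0.
by rewrite sumrB !common subrr normr0.
Qed.

Lemma share_secret_sharing : secret_sharing d.+1 0 0 share reconstruct.
Proof.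
split=> [m|m T dT|T m0 m1 Td]; first exact: law_distr card_coins_gt0.
  rewrite sum_law_if big1 ?mul0r // => r _.
  by rewrite reconstruct_deal // eqxx.
by rewrite share_private.
Qed.

Section Leakage.
Variables (mu : nat) (T K : {set 'I_p}) (Lam : shares p N -> 'M[R[i]]_(2 ^ mu)).
Hypotheses (Td : (#|T| <= d)%N) (Kd : (#|K| <= d)%N).
Hypothesis LamK : forall y, Lam y = Lam (Defs.mask K y).
Hypothesis Lam_density : forall y, is_density (Lam y).
Variables (P : 'M[R[i]]_(#|{: shares p N}| * 2 ^ mu)).

(** Weight that the distinguisher [P] gives to register value [y] with quantum part [X]; [X] may be
    a difference of unnormalized states. *)
Definition test (y : shares p N) (X : 'M[R[i]]_(2 ^ mu)) : R :=
  Re (\tr (P *m (delta_mx (enum_rank y) (enum_rank y) *t X))).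

Lemma testE y X : test y X = \sum_i \sum_j
  Re (P (mxtens_index (enum_rank y, i)) (mxtens_index (enum_rank y, j)) * X j i).
Proof. by rewrite /test trace_block Re_sum; apply: eq_bigr => i _; rewrite Re_sum. Qed.

Lemma testB y : {morph test y : X Z / X - Z}.
Proof.
move=> X Z; rewrite !testE -sumrB; apply: eq_bigr => i _; rewrite -sumrB; apply: eq_bigr => j _.
by rewrite !mxE mulrBr Re_add Re_opp.
Qed.

Lemma test_sum y (I : finType) (X : I -> 'M[R[i]]_(2 ^ mu)) :
  test y (\sum_k X k) = \sum_k test y (X k).
Proof.
under [RHS]eq_bigr do rewrite testE.
rewrite testE [RHS]exchange_big; apply: eq_bigr => i _.
rewrite [RHS]exchange_big; apply: eq_bigr => j _ /=.
by rewrite summxE mulr_sumr Re_sum.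
Qed.

Lemma test_leak_state m :
  Re (\tr (P *m leak_state share T Lam m))
    = (\sum_r test (Defs.mask T (deal m r)) (Lam (deal m r))) / #|{: coins}|%:R.
Proof.
rewrite -(sum_law _ (fun y => test (Defs.mask T y) (Lam y))) /leak_state mulmx_sumr.
rewrite (raddf_sum (@mxtrace _ _)) /= Re_sum; apply: eq_bigr => y _.
by rewrite -scalemxAr mxtraceZ Re_mul /toC /= mul0r subr0.
Qed.

(* [blind (kT - kK)] agrees on [K] with [1 + blind kT], which vanishes on [T].  So shifting the
   coins by [Phi x *: (kT - kK)] encrypts the secret seen by [K] with the one-time pad [x],
   and the shares in [T] depend on [x] but not on the secret. *)
Lemma test_deal_one_time_pad (kT kK : 'rV[F]_d) m (x : 'rV['F_2]_N) :
  (forall i, i \in T -> blind kT i = -1) -> (forall i, i \in K -> blind kK i = -1) ->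
  \sum_r test (Defs.mask T (deal m r)) (Lam (deal m r))
    = \sum_c test (Defs.mask T (to_shares (fun i => blind c i - Phi x * (1 + blind kK i))))
        (\sum_w Lam (Defs.mask K (to_shares (fun i =>
            blind c i + Phi (x + encode phi psi (row_of_bits m) w) * (1 + blind kT i))))).
Proof.
move=> kTE kKE; under [RHS]eq_bigr do rewrite test_sum.
rewrite (sum_coins m (fun w => Phi x *: (kT - kK) + secret m w *: kT)
           (fun y => test (Defs.mask T y) (Lam y))).
rewrite [RHS]exchange_big /=; apply: eq_bigr => w _; apply: eq_bigr => c _.
have dealE i : secret m w + blind (c + (Phi x *: (kT - kK) + secret m w *: kT)) i
    = secret m w + (blind c i + (Phi x * (blind kT i - blind kK i) + secret m w * blind kT i)).
  by rewrite !(blindingD, blindingZ) -(scaleN1r kK) blindingZ mulN1r.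
apply: f_equal2.
  apply: mask_to_shares => i iT /=; rewrite dealE kTE //; ring.
rewrite LamK; congr (Lam _); apply: mask_to_shares => i iK /=.
by rewrite dealE kKE // PhiD -/(secret m w); ring.
Qed.

Lemma leak_state_distinguish_le m0 m1 h : is_projector P -> (0 < l)%N -> (mu <= h + h)%N ->
  Re (\tr (P *m (leak_state share T Lam m0 - leak_state share T Lam m1)))
    <= 2 * l%:R * 2 ^+ h / 2 ^+ s.
Proof.
move=> projP l_gt0 mu_le.
have [kT kTE] := blinding_cancel alpha_neq0 Td.
have [kK kKE] := blinding_cancel alpha_neq0 Kd.
pose M : R := #|{: 'rV['F_2]_N}|%:R.
have M_gt0 : 0 < M by rewrite ltr0n; apply/card_gt0P; exists 0.
pose eta : R := 2 * (l%:R * 2 ^+ s).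
have pow_gt0 n : 0 < 2 ^+ n :> R by rewrite exprn_gt0.
have eta_gt0 : 0 < eta by rewrite !mulr_gt0 ?ltr0n.
pose H c (z : 'rV['F_2]_N) := Lam (Defs.mask K (to_shares (fun i =>
            blind c i + Phi z * (1 + blind kT i)))).
pose Y (c : 'rV[F]_d) x := Defs.mask T (to_shares (fun i => blind c i - Phi x * (1 + blind kK i))).
pose X c x := \sum_w H c (x + encode phi psi (row_of_bits m0) w)
            - \sum_w H c (x + encode phi psi (row_of_bits m1) w).
(* The one-time-pad identity holds for every pad x, so summing it over all pads multiplies the left
   side by [M]. *)
have sumE : M * (\sum_r test (Defs.mask T (deal m0 r)) (Lam (deal m0 r))
               - \sum_r test (Defs.mask T (deal m1 r)) (Lam (deal m1 r)))
          = \sum_c \sum_x test (Y c x) (X c x).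
  rewrite exchange_big /M mulr_natl -sumr_const; apply: eq_bigr => x _.
  rewrite !(test_deal_one_time_pad _ x kTE kKE) -sumrB.
  by apply: eq_bigr => c _; rewrite -testB.
have sum_le c : \sum_x test (Y c x) (X c x) <= M * (eta * 2 ^+ h).
  (* This weight balances the two terms: each is then at most M eta 2^h / 2. *)
  pose lam : R := eta / 2 ^+ h.
  have lam_gt0 : 0 < lam by rewrite divr_gt0.
  apply: le_trans (_ : \sum_x (lam / 2 * (2 ^ mu)%:R + (2 * lam)^-1 * frobenius_sq (X c x)) <= _).
    by apply: ler_sum => x _; exact: Re_trace_block_le.
  rewrite big_split /= sumr_const -mulr_sumr -(mulr_natl _ #|_|) -/M.
  have fro_le : \sum_x frobenius_sq (X c x) <= eta ^+ 2 * M.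
    apply: le_trans (frobenius_convolution_le _ (fun b => encode_bias_diff R phiK psiK phiD b _ _)) _.
    apply: ler_wpM2l; first exact: sqr_ge0.
    rewrite /M -sumr_const; apply: ler_sum => x _; exact/density_frobenius_le1/Lam_density.
  have mu_leR : (2 ^ mu)%:R <= 2 ^+ h * 2 ^+ h :> R.
    by rewrite -exprD -natrX ler_nat leq_exp2l.
  have -> : M * (eta * 2 ^+ h) = M * (lam / 2 * (2 ^+ h * 2 ^+ h)) + (2 * lam)^-1 * (eta ^+ 2 * M).
    by rewrite /lam; field; rewrite !gt_eqF.
  apply: lerD.
    by rewrite (ler_wpM2l (ltW M_gt0)) // ler_wpM2l // divr_ge0 // ltW.
  by rewrite ler_wpM2l // invr_ge0 mulr_ge0 // ltW.
rewrite mulmxBr (raddfB (@mxtrace _ _)) /= Re_add Re_opp !test_leak_state -mulrBl.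
(* Dividing by the 2^(2s) seeds turns eta 2^h into the claimed 2 l 2^h / 2^s. *)
have card_coins : #|{: coins}|%:R = 2 ^+ s * 2 ^+ s * #|{: 'rV[F]_d}|%:R :> R.
  by rewrite !card_prod !card_mx !card_ord !mul1n !natrM natrX.
have C_gt0 : 0 < #|{: 'rV[F]_d}|%:R :> R by rewrite ltr0n; apply/card_gt0P; exists 0.
rewrite card_coins ler_pdivrMr ?mulr_gt0 // -(ler_pM2l M_gt0) sumE.
apply: le_trans (ler_sum _ (fun c _ => sum_le c)) _.
have -> : \sum_(c : 'rV[F]_d) M * (eta * 2 ^+ h) = #|{: 'rV[F]_d}|%:R * (M * (eta * 2 ^+ h)).
  by rewrite sumr_const mulr_natl.
rewrite le_eqVlt; apply/orP; left; apply/eqP.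
by rewrite /eta; field; rewrite gt_eqF.
Qed.
End Leakage.

Lemma share_leakage_resilient mu k h : (k <= d)%N -> (0 < l)%N -> (mu <= h + h)%N ->
  leakage_resilient d.+1 k mu (2 * l%:R * 2 ^+ h / 2 ^+ s) share.
Proof.
move=> kd l_gt0 mu_le T K Lam [Td Kk LamK Lam_density] m0 m1.
apply: ge_sup.
  (* The zero projector shows that the set under the supremum is nonempty. *)
  exists (Re (\tr (0 *m (leak_state share T Lam m0 - leak_state share T Lam m1)))), 0 => //=.
  by split; rewrite ?mul0mx // /adjmx map_mx0 trmx0.
move=> _ [P projP <-].
by apply: leak_state_distinguish_le projP l_gt0 mu_le => //; exact: leq_trans kd.
Qed.
End Scheme.

(** * Numerical estimates and choice of parameters *)

Definition ceil_sqrt (R : realType) (n : nat) : nat := (Num.truncn (Num.sqrt (n%:R : R))).+1.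

Lemma ceil_sqrt_ge (R : realType) n : (n <= ceil_sqrt R n * ceil_sqrt R n)%N.
Proof.
have /andP [_ lt_sqrt] := truncn_itv (sqrtr_ge0 (n%:R : R)).
rewrite -(ler_nat R) natrM -{1}[n%:R]sqr_sqrtr // expr2.
by apply: ler_pM; rewrite ?sqrtr_ge0 // ltW.
Qed.

Lemma ceil_sqrt_little_o (R : realType) (e : R) : 0 < e ->
  exists N : nat, forall n : nat, (N <= n)%N -> `|4 + 6 * (ceil_sqrt R n)%:R| <= e * n%:R.
Proof.
(* With r the square root of n and r >= 1, the left side is at most 4 + 6 (r + 1) <= 16 r, and 16 <=
   e r once r >= x. *)
move=> e_gt0; pose x := 16 / e + 1.
have x_ge1 : 1 <= x by rewrite lerDr divr_ge0 // ltW.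
exists (Num.truncn (x ^+ 2)).+1 => n le_n.
have /andP [_ lt_x] := truncn_itv (sqr_ge0 x).
have x_le : x ^+ 2 <= n%:R by rewrite (le_trans (ltW lt_x)) // ler_nat.
have /andP [le_sqrt _] := truncn_itv (sqrtr_ge0 (n%:R : R)).
rewrite ger0_norm; last by rewrite addr_ge0 // mulr_ge0.
rewrite /ceil_sqrt -natr1; set q := (Num.truncn _)%:R in le_sqrt *.
rewrite -{2}[n%:R]sqr_sqrtr //; set r := Num.sqrt _ in le_sqrt *.
have x_le_r : x <= r by rewrite -[x]ger0_norm ?(le_trans ler01) // -sqrtr_sqr ler_wsqrtr.
have er : 16 <= e * r.
  apply: le_trans (_ : e * x <= _); last by rewrite ler_wpM2l // ltW.
  by rewrite /x mulrDr mulrCA divff ?gt_eqF // !mulr1 lerDl ltW.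
by nra.
Qed.

Lemma exists_nonzero_points (F : finFieldType) (p : nat) : (p < #|F|)%N ->
  exists alpha : 'I_p -> F, injective alpha /\ forall i, alpha i != 0.
Proof.
move=> lt_p; have le_p : (p <= #|predC1 (0%R : F)|)%N by rewrite cardC1 -ltnS (ltn_predK lt_p).
exists (fun i => enum_val (widen_ord le_p i)); split=> [i j /enum_val_inj [] /val_inj //|i].
by have := enum_valP (widen_ord le_p i).
Qed.

(** For q >= 1 one has x <= q^2 <= q^3; for q = 0 the hypotheses force x = 0. *)
Lemma powR_cube_root_le (R : realType) (x : R) (q : nat) : 0 <= x -> x <= q%:R ^+ 2 ->
  x `^ (3%:R^-1) <= q%:R.
Proof.
move=> x_ge0 x_le; case: q => [|q] in x_le *.
  have -> : x = 0 by apply/eqP; rewrite eq_le x_ge0 (le_trans x_le) // expr0n.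
  by rewrite powR0 // invr_eq0 pnatr_eq0.
have -> : q.+1%:R = (q.+1%:R ^+ 3) `^ (3%:R^-1) :> R.
  by rewrite -powR_mulrn // -powRrM divff ?pnatr_eq0 // powRr1.
rewrite ge0_ler_powR ?nnegrE ?exprn_ge0 ?invr_ge0 // (le_trans x_le) //.
by rewrite ler_weXn2l // ler1n.
Qed.

Theorem theoremC1 (R : realType) :
  exists (g : nat -> R) (c : R) (d : nat),
    [/\ (* g(n) = o(n) *)
        (forall e : R, 0 < e -> exists N : nat, forall n : nat, (N <= n)%N -> `|g n| <= e * n%:R),
        0 < c &
        forall mu k t p l : nat, (k < t)%N -> (t + k <= p)%N -> (p <= l)%N ->
          exists (l' : nat) (Share : bitstr l -> shares p l' -> R)
                 (Rec : {set 'I_p} -> shares p l' -> bitstr l),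
            [/\ l'%:R <= (l + mu)%:R + g (l + mu)%N,
                secret_sharing t 0 0 Share Rec &
                leakage_resilient t k mu
                  (p%:R * 2 `^ (- (c * ((l + mu)%:R / p%:R) `^ (3%:R^-1)
                                     / (ln ((l + mu)%:R + 2)) ^+ d)))
                  Share]].
Proof.
(* The overhead is 2 s - mu <= 4 + 6 q for the [s] chosen below. With c = 1 and d = 0 the
   logarithmic factor equals 1. *)
exists (fun n => 4 + 6 * (ceil_sqrt R n)%:R), 1, 0; split=> //.
  exact: ceil_sqrt_little_o.
move=> mu k [//|d] p l kd tkp pl; set q := ceil_sqrt R (l + mu).
have q_ge : (l + mu <= q * q)%N := ceil_sqrt_ge R (l + mu).
(* The error 2 l 2^h / 2^s becomes l / 2^(3q): two of the three q absorb l <= q^2 <= 2^(2q), and the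
   third leaves 2^(-q). *)
pose h := mu./2.+1; pose s := (h + 3 * q).+1.
have mu_h : (mu <= h + h <= mu + 2)%N.
  by have := odd_double_half mu; rewrite /h -addnn; case: odd => /=; lia.
have p_gt0 : (0 < p)%N by lia.
have [L [phi [psi [phiK psiK phiD]]]] := binary_field_exists (isT : 0 < s)%N.
have N_gt0 : (0 < l + (s + s))%N by lia.
have [F [Phi [Psi [PhiK PsiK PhiD]]]] := binary_field_exists N_gt0.
have cardF : #|F| = (2 ^ (l + (s + s)))%N.
  by rewrite -(bij_eq_card (Bijective PhiK PsiK)) card_mx card_ord mul1n.
have [alpha [alpha_inj alpha_neq0]] : exists alpha : 'I_p -> F,
    injective alpha /\ forall i, alpha i != 0.
  (* The field is large enough since p <= l and n < 2^n. *)
  apply: exists_nonzero_points; rewrite cardF.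
  by apply: leq_ltn_trans (ltn_expl _ (ltnSn 1)); lia.
exists (l + (s + s))%N, (share R d phi psi Phi Psi alpha), (reconstruct d phi psi Phi Psi alpha).
split.
- have : (l + (s + s) <= l + mu + (4 + 6 * q))%N by rewrite /s; lia.
  by rewrite -(ler_nat R) !natrD natrM.
- exact: share_secret_sharing.
move=> T K Lam fam m0 m1.
have l_gt0 : (0 < l)%N by lia.
have /andP [mu_le _] := mu_h.
have := share_leakage_resilient Psi phiK psiK phiD PhiD alpha_neq0 (kd : k <= d)%N l_gt0
  mu_le fam m0 m1.
move=> /le_trans; apply.
rewrite expr0 divr1 mul1r.
have hash_le : 2 * l%:R * 2 ^+ h / 2 ^+ s <= (2 ^+ q)^-1 :> R.
  rewrite ler_pdivrMr ?exprn_gt0 // ler_pdivlMl ?exprn_gt0 //.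
  rewrite -!natrX -!natrM ler_nat.
  have q_lt : (q < 2 ^ q)%N by exact: ltn_expl.
  have l_le : (l <= 2 ^ q * 2 ^ q)%N.
    by rewrite (leq_trans _ (leq_mul (ltnW q_lt) (ltnW q_lt))) //; lia.
  have -> : (2 ^ s = 2 ^ q * (2 * (2 ^ q * 2 ^ q) * 2 ^ h))%N.
    by rewrite -!expnD -expnS -!expnD; congr (_ ^ _)%N; rewrite /s; lia.
  by rewrite leq_mul2l leq_mul2r leq_mul2l l_le !orbT.
apply: le_trans hash_le _.
(* As p >= 1, the ratio is at most l + mu <= q^2, so 2^(-q) lies below the required power of 2; the
   factor p >= 1 only enlarges the target. *)
have exponent_le : ((l + mu)%:R / p%:R) `^ 3%:R^-1 <= q%:R :> R.
  apply: powR_cube_root_le; first by rewrite divr_ge0.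
  rewrite ler_pdivrMr ?ltr0n // -natrX -natrM ler_nat; nia.
rewrite -[leLHS]mul1r; apply: ler_pM; rewrite ?invr_ge0 ?exprn_ge0 ?ler1n //.
rewrite powRN lef_pV2 ?posrE ?exprn_gt0 ?powR_gt0 //.
by rewrite -powR_mulrn // ler_powR // ler1n.
Qed.
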